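(* Let $r$ be a positive integer and $s$ a non-negative integer, with $r\neq 6$. Then a solution to $(4,3)$-HWP$(48;r,s)$ exists if and only if $r+s=23$.
   Context: $K_{48}-I$ denotes the complete graph on $48$ vertices with the edges of a perfect matching $I$ removed. A $C_k$-factor of a graph is a spanning subgraph each of whose components is a cycle of length $k$. A solution to $(4,3)$-HWP$(48;r,s)$ is a partition of the edge set of $K_{48}-I$, for some perfect matching $I$, into $r$ $C_4$-factors and $s$ $C_3$-factors. *)

(* Defs.v *)
From mathcomp Require Import all_boot.
Set Implicit Arguments. Unset Strict Implicit. Unset Printing Implicit Defensive.

Section Graphs.
Variable T : finType.

(* An edge is a 2-element subset of the vertex set; a (simple) graph on T is
   given by its edge set, a set of 2-element subsets. *)

Definition cycle_edges (s : seq T) : {set {set T}} :=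
  [set [set p.1; p.2] | p in zip s (rot 1 s)].

Definition is_Ck_factor (k : nat) (F : {set {set T}}) : Prop :=
  3 <= k /\
  exists (P : {set {set T}}) (c : {set T} -> seq T),
    [/\ partition P [set: T],
        (forall B, B \in P ->
           [/\ uniq (c B), size (c B) = k & [set x in c B] = B])
      & F = \bigcup_(B in P) cycle_edges (c B)].

Definition perfect_matching (I : {set {set T}}) : Prop :=
  (forall e, e \in I -> #|e| = 2) /\
  (forall v : T, #|[set e in I | v \in e]| = 1).

Definition complete_minus (I : {set {set T}}) : {set {set T}} :=
  [set e : {set T} | (#|e| == 2) && (e \notin I)].

End Graphs.

Definition HWP43 (v r s : nat) : Prop :=
  exists (I : {set {set 'I_v}}) (F : 'I_(r + s) -> {set {set 'I_v}}),
    [/\ perfect_matching I,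
        (forall i : 'I_(r + s), i < r -> is_Ck_factor 4 (F i)),
        (forall i : 'I_(r + s), r <= i -> is_Ck_factor 3 (F i)),
        (forall i j : 'I_(r + s), i != j -> [disjoint F i & F j])
      & \bigcup_(i < r + s) F i = complete_minus I].

(* Main.v *)
Require Import Defs.
From mathcomp Require Import all_boot.
Set Implicit Arguments. Unset Strict Implicit. Unset Printing Implicit Defensive.

(** Every factor has degree 2 at every vertex, so r + s = 23 is a degree count;
    the same count shows that the edges left over by 23 disjoint factors form a
    perfect matching, so for existence it suffices to give disjoint factors.

    Split the 48 points into four copies of Z_12. Each copy of K_12 minus a
    matching is decomposed into q C_4-factors and 5 - q C_3-factors, for any q
    in {1, ..., 5}. The edges between the copies are decomposed into 18 factors
    that come in six triples, each triple developed over Z_12 from one base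
    class of disjoint short cycles meeting every residue class mod 3 of every
    copy once; t of the six base classes consist of 4-cycles and the others of
    triangles. Every r from 1 to 23 is 3 t + q for some t <= 6 and such a q. *)

(** * Lists of lists without repetition *)

(** Serves twice: for lists of vertices it makes the cycles of a factor disjoint, for lists of edge
    keys it makes the factors edge-disjoint. *)
Lemma flatten_uniq_index (A : eqType) (ss : seq (seq A)) x i j :
  uniq (flatten ss) -> x \in nth [::] ss i -> x \in nth [::] ss j -> i = j.
Proof.
have mem_nth_flatten k (tt : seq (seq A)) :
    x \in nth [::] tt k -> x \in flatten tt.
  case: (ltnP k (size tt)) => [lt_k xk|le_k]; last by rewrite nth_default.
  by apply/flattenP; exists (nth [::] tt k); rewrite // mem_nth.
elim: ss i j => [|s ss IHss] [|i] [|j] //=;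
  rewrite cat_uniq => /and3P[_ /hasPn s'ss Uss].
- by move=> xs /mem_nth_flatten/s'ss; rewrite /= xs.
- by move=> /mem_nth_flatten/s'ss /negP xs /xs.
- by move=> xi xj; congr _.+1; apply: IHss.
Qed.

Lemma flatten_uniq_mem (A : eqType) (ss : seq (seq A)) s :
  uniq (flatten ss) -> s \in ss -> uniq s.
Proof.
move=> Uss ss_s; case/splitPr: ss_s Uss => ss1 ss2.
by rewrite flatten_cat /= !cat_uniq => /and3P[_ _ /andP[]].
Qed.

Lemma mem_bigcup_seq (T : finType) A (ss : seq A) (G : A -> {set T}) x :
  (x \in \bigcup_(s <- ss) G s) = has (fun s => x \in G s) ss.
Proof.
by elim: ss => [|s ss IHss]; rewrite (big_nil, big_cons) inE // IHss.
Qed.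

(** * Cycles, cycle factors and vertex degrees *)

Section CycleFactors.
Variable T : finType.
Implicit Types (s c : seq T) (F : {set {set T}}).

Lemma mem_cycle_edgesP s (e : {set T}) :
  reflect (exists2 p, p \in zip s (rot 1 s) & e = [set p.1; p.2])
          (e \in cycle_edges s).
Proof. exact: imsetP. Qed.

(** Rotating by one step only permutes the list of consecutive pairs. Hence any vertex of a cycle
    may be assumed to come first. *)
Lemma cycle_edges_rot n s : cycle_edges (rot n s) = cycle_edges s.
Proof.
have rot1 (t : seq T) : cycle_edges (rot 1 t) = cycle_edges t.
  case: t => [//|x [//|y t]].
  apply/setP=> e; apply/idP/idP=> /mem_cycle_edgesP[p ps ->];
    apply/mem_cycle_edgesP; exists p => //; move: ps;
    by rewrite !(rot1_cons, rcons_cons) -rcons_cons zip_rcons ?size_rcons //=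
         mem_rcons.
elim: n s => [|n IHn] s; first by rewrite rot0.
case: (ltnP n (size s)) => [lt_n|le_n]; last by rewrite rot_oversize // leqW.
by rewrite rotS // rot1 IHn.
Qed.

Lemma cycle_edges_sub s e : e \in cycle_edges s -> e \subset s.
Proof.
case/mem_cycle_edgesP=> -[x y] /= /[dup] /(map_f fst) xs /(map_f snd) ys ->.
rewrite -/(unzip1 _) -/(unzip2 _) in xs ys.
rewrite unzip1_zip ?size_rot // in xs; rewrite unzip2_zip ?size_rot // in ys.
rewrite mem_rot in ys.
by apply/subsetP=> z; rewrite !inE => /orP[]/eqP->.
Qed.

(** Once [v] is rotated to the front, its neighbours are the second and the last entry of the list;
    these differ because there are at least three entries. *)
Lemma cycle_edges_at s v : uniq s -> 2 < size s -> v \in s ->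
  exists u w, [/\ u != v, w != v, u != w &
    [set e in cycle_edges s | v \in e] = [set [set v; w]; [set v; u]]].
Proof.
move=> Us s3 vs; have [i s' def_s] := rot_to vs.
rewrite -(cycle_edges_rot i) def_s.
move: Us s3; rewrite -(rot_uniq i) -(size_rot i) def_s {def_s vs i s}.
case: s' => [//|w s']; case/lastP: s' => [//|t u] Us _.
have [v_w_u vt wu wt ut] :
  [/\ (u != v) && (w != v), v \notin t, u != w, w \notin t & u \notin t].
  move: Us; rewrite /= !inE !mem_rcons !inE !negb_or rcons_uniq.
  by case/and3P=> /and3P[vw vu ->] /andP[wu ->] /andP[-> _]; split=> //;
    rewrite eq_sym // vu eq_sym.
have [uv wv] := andP v_w_u; exists u, w; split=> //.
apply/setP=> e; rewrite !inE; apply/andP/orP.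
- case=> /mem_cycle_edgesP[[a b]]; rewrite rot1_cons rcons_cons /=.
  rewrite -rcons_cons zip_rcons ?size_rcons // inE mem_rcons inE.
  case/or3P=> [/eqP[-> ->] -> _|/eqP[-> ->] -> _|ab ->]; first by left.
    by right; rewrite setUC.
  move: (map_f fst ab) (map_f snd ab).
  rewrite -/(unzip1 _) -/(unzip2 _) unzip1_zip ?unzip2_zip ?size_rcons //=.
  rewrite inE mem_rcons inE => aw bu; rewrite !inE => /orP[]/eqP def_v; subst v.
  + by case/orP: aw wv vt => [/eqP->|->]; rewrite ?eqxx.
  + by case/orP: bu uv vt => [/eqP->|->]; rewrite ?eqxx.
- case=> /eqP->; (split; last by rewrite !inE eqxx).
  + apply/mem_cycle_edgesP; exists (v, w) => //.
    by rewrite rot1_cons rcons_cons /= inE eqxx.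
  + apply/mem_cycle_edgesP; exists (u, v); last by rewrite setUC.
    rewrite rot1_cons rcons_cons /= -rcons_cons zip_rcons ?size_rcons //.
    by rewrite inE mem_rcons inE eqxx orbT.
Qed.

Lemma degree_cycle s v : uniq s -> 2 < size s -> v \in s ->
  #|[set e in cycle_edges s | v \in e]| = 2.
Proof.
move=> Us s3 /(cycle_edges_at Us s3)[u [w [uv wv uw ->]]].
rewrite cards2; suff ->: [set v; w] != [set v; u] by [].
apply/eqP=> /setP/(_ w); rewrite !inE eqxx orbT (negPf wv) eq_sym.
by rewrite (negPf uw).
Qed.

Lemma cycle_edges_card2 s e :
  uniq s -> 2 < size s -> e \in cycle_edges s -> #|e| = 2.
Proof.
move=> Us s3 es; have /mem_cycle_edgesP[[v b] _ def_e] := es.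
have ve : v \in e by rewrite def_e !inE eqxx.
have vs : v \in s by apply: (subsetP (cycle_edges_sub es)).
have [u [w [uv wv _ /setP/(_ e)]]] := cycle_edges_at Us s3 vs.
rewrite !inE es ve => /esym.
by case/orP=> /eqP->; rewrite cards2 eq_sym ?uv ?wv.
Qed.

Lemma Ck_factor_card2 k F e : is_Ck_factor k F -> e \in F -> #|e| = 2.
Proof.
case=> k3 [P [c [_ cP ->]]] /bigcupP[B BP].
by have [Uc sc _] := cP B BP; apply: cycle_edges_card2; rewrite // sc.
Qed.

(** Each cycle stays inside its own block, so only the cycle on the block of [v] contributes edges
    at [v]. *)
Lemma degree_Ck_factor k F v :
  is_Ck_factor k F -> #|[set e in F | v \in e]| = 2.
Proof.
case=> k3 [P [c [/and3P[/eqP covP trivP _] cP ->]]].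
have vP : v \in cover P by rewrite covP.
have BP := pblock_mem vP; have [Uc sc defB] := cP _ BP.
have vc : v \in c (pblock P v).
  by have := vP; rewrite -mem_pblock -{1}defB inE.
rewrite -(degree_cycle Uc _ vc) ?sc //.
congr #|pred_of_set _|; apply/setP=> e; rewrite !inE; apply: andb_id2r => ve.
apply/bigcupP/idP => [[B B_P eB]|eB]; last by exists (pblock P v).
suff <- : B = pblock P v by [].
apply/esym/(def_pblock trivP B_P).
have [_ _ <-] := cP B B_P; rewrite inE.
exact: (subsetP (cycle_edges_sub eB)).
Qed.

Lemma degree_complete v : #|[set e : {set T} | #|e| == 2 & v \in e]| = #|T|.-1.
Proof.
have -> : [set e : {set T} | #|e| == 2 & v \in e]
          = [set [set v; w] | w in [set~ v]].
  apply/setP=> e; rewrite !inE; apply/andP/imsetP.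
  - case=> /cards2P[a [b [ab ->]]]; rewrite !inE => /orP[]/eqP->.
    + by exists b; rewrite ?inE // eq_sym.
    + by exists a; rewrite ?inE // setUC.
  - by case=> w; rewrite !inE => wv ->; rewrite cards2 (eq_sym v) wv !inE eqxx.
rewrite card_in_imset ?cardsC1 // => a b; rewrite !inE => av bv /setP/(_ a).
by rewrite !inE eqxx orbT (negPf av) => /esym/eqP.
Qed.

(** Double counting: by disjointness the indicator of the union is the sum of the indicators of the
    [F i], and exchanging the sums leaves [n] terms equal to 2. *)
Lemma degree_union n (F : 'I_n -> {set {set T}}) v :
    (forall i j, i != j -> [disjoint F i & F j]) ->
    (forall i, exists k, is_Ck_factor k (F i)) ->
  #|[set e in \bigcup_i F i | v \in e]| = n.*2.
Proof.
move=> disF CF.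
have memF e : (e \in \bigcup_i F i) = \sum_i (e \in F i) :> nat.
  have [/bigcupP[i _ eF]|noF] := boolP (e \in _).
    rewrite (bigD1 i) //= eF big1 // => j ji.
    by have /pred0P/(_ e)/= := disF _ _ ji; rewrite eF andbT => ->.
  rewrite big1 // => i _; apply/eqP; rewrite eqb0.
  by apply: contra noF => eF; apply/bigcupP; exists i.
have card_at (A : {set {set T}}) :
    #|[set e in A | v \in e]| = \sum_(e : {set T} | v \in e) (e \in A).
  rewrite -sum1dep_card big_mkcond [RHS]big_mkcond; apply: eq_bigr => e _.
  by case: (e \in A); case: (v \in e).
rewrite card_at (eq_bigr _ (fun e _ => memF e)) exchange_big /=.
rewrite (eq_bigr (fun=> 2)) => [|i _]; last first.
  by rewrite -card_at; have [k] := CF i; apply: degree_Ck_factor.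
by rewrite sum_nat_const card_ord muln2.
Qed.

(** Bridge from explicit lists of cycles to the definition by a partition and a choice of a cyclic
    order on each block. *)
Lemma Ck_factor_of_seq k (cs : seq (seq T)) :
    2 < k -> all (fun c => size c == k) cs ->
    uniq (flatten cs) -> (forall x, x \in flatten cs) ->
  is_Ck_factor k (\bigcup_(c <- cs) cycle_edges c).
Proof.
move=> k3 /allP sz_cs Ucs cs_all.
pose S c := [set x in c : seq T].
have same c d x : c \in cs -> d \in cs -> x \in c -> x \in d -> c = d.
  move=> /(nthP [::])[i _ <-] /(nthP [::])[j _ <-] xi xj.
  by rewrite (flatten_uniq_index Ucs xi xj).
have cs_ne c : c \in cs -> exists x, x \in c.
  move=> /sz_cs; case: c => [/eqP sz0|x c _]; first by rewrite -sz0 in k3.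
  by exists x; rewrite mem_head.
have S_inj : {in cs &, injective S}.
  move=> c d c_cs d_cs eqS; have [x xc] := cs_ne c c_cs.
  by apply: (same _ _ x) => //; move/setP/(_ x): eqS; rewrite !inE xc => <-.
pose P := [set B in [seq S c | c <- cs]].
(* Distinct lists of [cs] have distinct vertex sets, being disjoint and nonempty, so a block
   determines its list; [cyc] recovers it by position. *)
pose cyc (B : {set T}) := nth [::] cs (index B [seq S c | c <- cs]).
have cycK c : c \in cs -> cyc (S c) = c.
  move=> c_cs; apply: S_inj => //; last first.
    by rewrite -(nth_map _ set0) ?nth_index ?map_f //
               -(size_map S) index_mem map_f.
  by rewrite mem_nth // -(size_map S) index_mem map_f.
have PP B : B \in P -> exists2 c, c \in cs & B = S c.
  by rewrite inE => /mapP.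
split=> //; exists P, cyc; split.
- apply/and3P; split.
  + rewrite eqEsubset subsetT; apply/subsetP=> x _.
    have /flattenP[c c_cs xc] := cs_all x.
    by apply/bigcupP; exists (S c); rewrite !inE ?map_f.
  + apply/trivIsetP=> A B /PP[c c_cs ->] /PP[d d_cs ->].
    apply: contraNT => /pred0Pn[x]; rewrite /= !inE => /andP[xc xd].
    by rewrite (same c d x).
  + apply/negP=> /PP[c c_cs /setP S0]; have [x xc] := cs_ne c c_cs.
    by move: (S0 x); rewrite !inE xc.
- move=> B /PP[c c_cs ->]; rewrite cycK //; split=> //; last exact/eqP/sz_cs.
  exact: flatten_uniq_mem Ucs c_cs.
- apply/setP=> e; rewrite mem_bigcup_seq; apply/hasP/bigcupP.
  + by case=> c c_cs ec; exists (S c); rewrite ?cycK // inE map_f.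
  + by case=> B /PP[c c_cs ->]; rewrite cycK // => ec; exists c.
Qed.

End CycleFactors.

(** * Degree criteria for a solution *)

(** At any vertex, the [v - 1] edges of the complete graph split into one matching edge and two
    edges from each factor. *)
Lemma HWP43_necessary v r s : 0 < v -> HWP43 v r s -> v = (r + s).*2.+2.
Proof.
case: v => // v _ [I [F [[I2 I1] C4 C3 disF defU]]].
have CF i : exists k, is_Ck_factor k (F i).
  by case: (ltnP i r) => ir; [exists 4; apply: C4|exists 3; apply: C3].
pose x : 'I_v.+1 := ord0; have := degree_complete x.
have -> : [set e : {set 'I_v.+1} | #|e| == 2 & x \in e]
   = [set e in I | x \in e] :|: [set e in \bigcup_i F i | x \in e].
  apply/setP=> e; rewrite defU !inE -andb_orl; apply: andb_id2r => _.
  by have [/I2->|] := boolP (e \in I); rewrite ?andbT.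
rewrite cardsU disjoint_setI0 ?cards0 ?subn0; last first.
  rewrite -setI_eq0; apply/eqP/setP=> e; rewrite defU !inE.
  by case: (e \in I); rewrite ?andbF.
by rewrite I1 degree_union // card_ord /= => <-.
Qed.

(* The matching need not be prescribed: by the degree count, whatever
   the factors leave uncovered is one. *)
Lemma HWP43_sufficient v r s (F : 'I_(r + s) -> {set {set 'I_v}}) :
    v = (r + s).*2.+2 ->
    (forall i : 'I_(r + s), is_Ck_factor (if i < r then 4 else 3) (F i)) ->
    (forall i j, i != j -> [disjoint F i & F j]) ->
  HWP43 v r s.
Proof.
move=> def_v CF disF; pose U := \bigcup_i F i.
have U2 e : e \in U -> #|e| = 2.
  by case/bigcupP=> i _; apply: Ck_factor_card2 (CF i).
exists [set e : {set 'I_v} | (#|e| == 2) && (e \notin U)], F; split=> //.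
- split=> [e|x]; first by rewrite inE => /andP[/eqP].
  have degU : #|[set e in U | x \in e]| = (r + s).*2.
    by apply: degree_union => // i; eexists; apply: CF.
  have degK : #|[set e : {set 'I_v} | #|e| == 2 & x \in e]| = (r + s).*2.+1.
    by rewrite degree_complete card_ord def_v.
  have := cardsID [set e in U | x \in e]
    [set e : {set 'I_v} | #|e| == 2 & x \in e].
  rewrite degK (setIidPr _); last first.
    by apply/subsetP=> e; rewrite !inE => /andP[/U2-> ->].
  rewrite degU -(addn1 (r + s).*2) => /addnI deg1.
  rewrite -[RHS]deg1; apply: eq_card => e; rewrite !inE.
  by case: (x \in e); rewrite ?andbF ?andbT // andbC.
- by move=> i ir; have := CF i; rewrite ir.
- by move=> i ir; have := CF i; rewrite ltnNge ir.
- apply/setP=> e; rewrite !inE -/U.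
  by have [/U2->|] := boolP (e \in U); case: (#|e| == 2).
Qed.

(** * A computable test for decompositions *)

(** An undirected edge is encoded as the pair of its smaller and larger endpoint, so that comparing
    edges becomes comparing pairs of numbers. *)
Definition cycle_keys (c : seq nat) : seq (nat * nat) :=
  [seq (minn p.1 p.2, maxn p.1 p.2) | p <- zip c (rot 1 c)].

Definition factor_keys (cs : seq (seq nat)) := flatten (map cycle_keys cs).

(* Grouping the keys by their first component makes the duplicate test cheap. *)
Definition uniq_by_fst n (ks : seq (nat * nat)) : bool :=
  all (fun k => k.1 < n) ks &&
  all (fun a => uniq [seq k.2 | k <- ks & k.1 == a]) (iota 0 n).

Definition factor_of n k (cs : seq (seq nat)) : bool :=
  [&& all (fun c => size c == k) cs, uniq (flatten cs),
      all (gtn n) (flatten cs) & size (flatten cs) == n].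

(** A single duplicate test on the keys of all factors together replaces the pairwise disjointness
    tests. *)
Definition HWP43_check v r (fs : seq (seq (seq nat))) : bool :=
  [&& (size fs).*2.+2 == v,
      all (factor_of v 4) (take r fs), all (factor_of v 3) (drop r fs)
    & uniq_by_fst v (flatten (map factor_keys fs))].

(** Equal keys share their first component, so any repetition would show up inside one group. *)
Lemma uniq_by_fstW n ks : uniq_by_fst n ks -> uniq ks.
Proof.
case/andP=> /allP lt_n /allP U.
suff H : {in ks, forall k, uniq [seq k' <- ks | k'.1 == k.1]}.
  apply/count_mem_uniq => k; have [k_ks|/count_memPn//] := boolP (k \in ks).
  have U1 := H k k_ks.
  transitivity (count_mem k [seq k' <- ks | k'.1 == k.1]).
    rewrite count_filter; apply: eq_count => k' /=.
    by case: eqP => // ->; rewrite eqxx.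
  by rewrite count_uniq_mem // mem_filter eqxx k_ks.
move=> k /lt_n k_n; apply: (map_uniq (f := snd)).
by apply: U; rewrite mem_iota.
Qed.

Lemma zip_map2 A B C D (f : A -> C) (g : B -> D) s t :
  zip (map f s) (map g t) = [seq (f p.1, g p.2) | p <- zip s t].
Proof. by elim: s t => [|x s IHs] [|y t] //=; rewrite IHs. Qed.

(** * From lists of numbers to factors on ['I_n.+1] *)

Section Realization.
Variable n : nat.
(** [inord] sends numbers above [n] to 0; it is injective on the vertices of a factor thanks to the
    range test in [factor_of]. *)
Let vert (a : nat) : 'I_n.+1 := inord a.

Definition factor_edges (cs : seq (seq nat)) : {set {set 'I_n.+1}} :=
  \bigcup_(c <- map (map vert) cs) cycle_edges c.

Lemma mem_factor_edges cs e :
    all (gtn n.+1) (flatten cs) -> e \in factor_edges cs ->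
  exists a b : 'I_n.+1, e = [set a; b] /\
    (minn a b, maxn a b) \in factor_keys cs.
Proof.
move=> /allP lt_n; rewrite mem_bigcup_seq => /hasP[_ /mapP[c c_cs ->]].
case/mem_cycle_edgesP=> p; rewrite -map_rot zip_map2.
case/mapP=> -[x y] xy -> ->.
exists (vert x), (vert y); split=> //.
have lt_c z : z \in c -> z < n.+1.
  by move=> zc; apply: lt_n; apply/flattenP; exists c.
have xc : x \in c.
  by move/(map_f fst): xy; rewrite -/(unzip1 _) unzip1_zip ?size_rot.
have yc : y \in c.
  by move/(map_f snd): xy; rewrite -/(unzip2 _) unzip2_zip ?size_rot // mem_rot.
rewrite !inordK ?lt_c //; apply/flattenP; exists (cycle_keys c); first exact: map_f.
exact: (map_f (fun p : nat * nat => (minn p.1 p.2, maxn p.1 p.2)) xy).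
Qed.

Lemma Ck_factor_edges k cs :
  2 < k -> factor_of n.+1 k cs -> is_Ck_factor k (factor_edges cs).
Proof.
move=> k3 /and4P[sz_cs Ucs lt_n sz_n].
have Uv : uniq (flatten (map (map vert) cs)).
  rewrite -map_flatten map_inj_in_uniq // => x y.
  move=> /(allP lt_n) xn /(allP lt_n) yn.
  by move/(congr1 val); rewrite /= !inordK.
apply: Ck_factor_of_seq => //.
  by rewrite all_map; apply: sub_all sz_cs => c /=; rewrite size_map.
(* Coverage by counting: [n.+1] distinct elements exhaust a type of that size. *)
move=> x; suff: flatten (map (map vert) cs) =i 'I_n.+1 by move->.
apply/subset_cardP; last exact/subsetP.
by rewrite (card_uniqP Uv) -map_flatten size_map (eqP sz_n) card_ord.
Qed.

End Realization.

Lemma HWP43_checkP v r s fs :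
  HWP43_check v r fs -> r + s = size fs -> HWP43 v r s.
Proof.
case: v => [|v]; first by case/and4P.
case/and4P=> /eqP sz_v fs4 fs3 /uniq_by_fstW U def_sz.
have fs_i i : i < r + s ->
    factor_of v.+1 (if i < r then 4 else 3) (nth [::] fs i).
  rewrite def_sz => lt_i; case: ifP => [ir|/negbT]; last rewrite -leqNgt => ri.
    rewrite -(nth_take _ ir); apply: (all_nthP [::] fs4).
    by rewrite size_take_min leq_min ir.
  rewrite -(subnKC ri) -nth_drop; apply: (all_nthP [::] fs3); rewrite size_drop.
  by rewrite ltn_sub2r // (leq_ltn_trans ri).
pose F (i : 'I_(r + s)) := factor_edges v (nth [::] fs i).
apply: (HWP43_sufficient (F := F)) => [|i|i j]; first by rewrite def_sz sz_v.
  by apply: Ck_factor_edges; [case: ifP | apply: fs_i].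
apply: contraNT => /pred0Pn[e /= /andP[]].
have lt_n (k : 'I_(r + s)) : all (gtn v.+1) (flatten (nth [::] fs k)).
  by case/and4P: (fs_i k (ltn_ord k)).
case/(mem_factor_edges (lt_n i))=> a [b [-> key_i]].
case/(mem_factor_edges (lt_n j))=> a' [b' [ab key_j]].
(* The key depends only on the edge, not on the order in which its endpoints are listed. *)
have eq_key : (minn a b, maxn a b) = (minn a' b', maxn a' b').
  move: (set21 a b) (set22 a b); rewrite ab !inE.
  move: (set21 a' b') (set22 a' b'); rewrite -ab !inE.
  by do 4![case/orP=> /eqP ?]; subst; rewrite // minnC maxnC.
(* An edge common to [F i] and [F j] puts one key in both the [i]-th and the [j]-th key list. *)
apply/eqP/val_inj; apply: (flatten_uniq_index U (x := (minn a b, maxn a b))).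
  by rewrite (nth_map [::]) // -def_sz ltn_ord.
by rewrite eq_key (nth_map [::]) // -def_sz ltn_ord.
Qed.

(** * Explicit base classes and factors of K_12 *)

(* The 48 points are four copies of Z_12: the element x of copy g is 12 g + x.
   A base class, translated by the multiples of 3, gives one factor of the
   complete 4-partite graph between the copies; translating that factor by
   0, 1 and 2 gives three. *)
Definition shift (a x : nat) : nat := x %/ 12 * 12 + (x %% 12 + a) %% 12.

Definition develop (cs : seq (seq nat)) : seq (seq (seq nat)) :=
  [seq [seq map (shift (j + h)) c | h <- [:: 0; 3; 6; 9], c <- cs]
  | j <- iota 0 3].

Definition on_copies (cs : seq (seq nat)) : seq (seq nat) :=
  [seq map (addn (12 * g)) c | g <- iota 0 4, c <- cs].

(* Among the six base classes [base_classes t] the first t consist of 4-cycles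
   and the others of triangles; for each pair of copies g < g', their edges
   realize each difference in Z_12 exactly once. *)
Definition base_classes (t : nat) : seq (seq (seq nat)) :=
  match t with
  | 0 => [::
      [:: [:: 0; 22; 38]; [:: 1; 21; 26];
       [:: 2; 30; 42]; [:: 14; 25; 43]];
      [:: [:: 0; 31; 41]; [:: 1; 19; 45];
       [:: 2; 14; 24]; [:: 12; 32; 37]];
      [:: [:: 0; 23; 35]; [:: 1; 22; 44];
       [:: 2; 28; 39]; [:: 12; 30; 43]];
      [:: [:: 0; 24; 45]; [:: 1; 20; 43];
       [:: 2; 19; 32]; [:: 12; 28; 44]];
      [:: [:: 0; 14; 29]; [:: 1; 16; 37];
       [:: 2; 34; 41]; [:: 12; 33; 36]];
      [:: [:: 0; 13; 27]; [:: 1; 17; 47];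
       [:: 2; 35; 37]; [:: 12; 31; 39]]]
  | 1 => [::
      [:: [:: 0; 12; 46; 35]; [:: 1; 23; 34; 41];
       [:: 2; 30; 16; 36]];
      [:: [:: 0; 16; 33]; [:: 1; 18; 39];
       [:: 2; 31; 46]; [:: 14; 26; 44]];
      [:: [:: 0; 31; 47]; [:: 1; 14; 40];
       [:: 2; 21; 27]; [:: 13; 35; 36]];
      [:: [:: 0; 24; 36]; [:: 1; 21; 38];
       [:: 2; 20; 28]; [:: 13; 32; 37]];
      [:: [:: 0; 21; 30]; [:: 1; 16; 44];
       [:: 2; 34; 43]; [:: 14; 29; 39]];
      [:: [:: 0; 14; 45]; [:: 1; 12; 28];
       [:: 2; 24; 44]; [:: 13; 26; 40]]]
  | 2 => [::
      [:: [:: 0; 32; 15; 38]; [:: 1; 16; 28; 42];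
       [:: 2; 14; 43; 27]];
      [:: [:: 0; 20; 47; 34]; [:: 1; 15; 24; 46];
       [:: 2; 29; 19; 45]];
      [:: [:: 0; 21; 40]; [:: 1; 19; 27];
       [:: 2; 31; 39]; [:: 14; 29; 47]];
      [:: [:: 0; 31; 42]; [:: 1; 23; 47];
       [:: 2; 13; 32]; [:: 12; 30; 37]];
      [:: [:: 0; 16; 36]; [:: 1; 18; 29];
       [:: 2; 25; 46]; [:: 14; 27; 44]];
      [:: [:: 0; 24; 39]; [:: 1; 20; 34];
       [:: 2; 15; 37]; [:: 13; 29; 41]]]
  | 3 => [::
      [:: [:: 0; 13; 36; 28]; [:: 1; 24; 20; 47];
       [:: 2; 12; 29; 46]];
      [:: [:: 0; 20; 28; 43]; [:: 1; 12; 35; 39];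
       [:: 2; 19; 38; 24]];
      [:: [:: 0; 16; 37; 25]; [:: 1; 33; 12; 41];
       [:: 2; 29; 17; 39]];
      [:: [:: 0; 15; 45]; [:: 1; 19; 32];
       [:: 2; 31; 44]; [:: 14; 33; 40]];
      [:: [:: 0; 21; 41]; [:: 1; 27; 37];
       [:: 2; 16; 26]; [:: 14; 28; 39]];
      [:: [:: 0; 19; 47]; [:: 1; 34; 40];
       [:: 2; 14; 32]; [:: 12; 27; 36]]]
  | 4 => [::
      [:: [:: 0; 16; 25; 41]; [:: 1; 23; 29; 36];
       [:: 2; 30; 15; 40]];
      [:: [:: 0; 26; 13; 40]; [:: 1; 18; 42; 34];
       [:: 2; 17; 24; 38]];
      [:: [:: 0; 23; 46; 34]; [:: 1; 32; 18; 47];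
       [:: 2; 22; 36; 27]];
      [:: [:: 0; 12; 32; 43]; [:: 1; 30; 14; 45];
       [:: 2; 16; 38; 25]];
      [:: [:: 0; 27; 42]; [:: 1; 22; 40];
       [:: 2; 21; 26]; [:: 14; 25; 47]];
      [:: [:: 0; 13; 45]; [:: 1; 33; 38];
       [:: 2; 20; 32]; [:: 12; 34; 40]]]
  | 5 => [::
      [:: [:: 0; 25; 16; 39]; [:: 1; 20; 40; 32];
       [:: 2; 24; 18; 44]];
      [:: [:: 0; 28; 18; 40]; [:: 1; 22; 30; 39];
       [:: 2; 20; 47; 32]];
      [:: [:: 0; 13; 46; 32]; [:: 1; 24; 20; 36];
       [:: 2; 12; 41; 28]];
      [:: [:: 0; 12; 27; 37]; [:: 1; 17; 31; 47];
       [:: 2; 13; 26; 45]];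
      [:: [:: 0; 17; 28; 45]; [:: 1; 16; 41; 30];
       [:: 2; 29; 12; 43]];
      [:: [:: 0; 24; 36]; [:: 1; 15; 34];
       [:: 2; 22; 46]; [:: 14; 26; 44]]]
  (* The case t = 6. *)
  | _ => [::
      [:: [:: 0; 18; 42; 24]; [:: 1; 23; 35; 47];
       [:: 2; 16; 31; 46]];
      [:: [:: 0; 12; 37; 28]; [:: 1; 20; 24; 44];
       [:: 2; 19; 42; 29]];
      [:: [:: 0; 20; 29; 39]; [:: 1; 22; 37; 30];
       [:: 2; 25; 15; 44]];
      [:: [:: 0; 16; 34; 45]; [:: 1; 32; 18; 37];
       [:: 2; 17; 38; 24]];
      [:: [:: 0; 30; 17; 37]; [:: 1; 26; 19; 41];
       [:: 2; 15; 45; 28]];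
      [:: [:: 0; 33; 22; 38]; [:: 1; 12; 32; 36];
       [:: 2; 34; 17; 43]]]
  end.

(* q C_4-factors followed by 5 - q C_3-factors of K_12 minus a matching. *)
Definition K12_factors (q : nat) : seq (seq (seq nat)) :=
  match q with
  | 1 => [::
      [:: [:: 0; 4; 2; 10]; [:: 1; 6; 5; 8]; [:: 3; 9; 7; 11]];
      [:: [:: 0; 1; 2]; [:: 3; 4; 5]; [:: 6; 7; 8]; [:: 9; 10; 11]];
      [:: [:: 0; 6; 11]; [:: 1; 5; 9]; [:: 2; 3; 7]; [:: 4; 8; 10]];
      [:: [:: 0; 3; 8]; [:: 1; 7; 10]; [:: 2; 5; 11]; [:: 4; 6; 9]];
      [:: [:: 0; 5; 7]; [:: 1; 4; 11]; [:: 2; 8; 9]; [:: 3; 6; 10]]]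
  | 2 => [::
      [:: [:: 0; 4; 1; 6]; [:: 2; 7; 5; 11]; [:: 3; 9; 8; 10]];
      [:: [:: 0; 3; 6; 9]; [:: 1; 7; 11; 8]; [:: 2; 4; 10; 5]];
      [:: [:: 0; 1; 2]; [:: 3; 4; 5]; [:: 6; 7; 8]; [:: 9; 10; 11]];
      [:: [:: 0; 7; 10]; [:: 1; 5; 9]; [:: 2; 3; 8]; [:: 4; 6; 11]];
      [:: [:: 0; 5; 8]; [:: 1; 3; 11]; [:: 2; 6; 10]; [:: 4; 7; 9]]]
  | 3 => [::
      [:: [:: 0; 7; 3; 8]; [:: 1; 9; 4; 10]; [:: 2; 5; 11; 6]];
      [:: [:: 0; 4; 7; 11]; [:: 1; 3; 2; 8]; [:: 5; 9; 6; 10]];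
      [:: [:: 0; 6; 3; 10]; [:: 1; 4; 2; 11]; [:: 5; 7; 9; 8]];
      [:: [:: 0; 1; 2]; [:: 3; 4; 5]; [:: 6; 7; 8]; [:: 9; 10; 11]];
      [:: [:: 0; 3; 9]; [:: 1; 5; 6]; [:: 2; 7; 10]; [:: 4; 8; 11]]]
  | 4 => [::
      [:: [:: 0; 4; 8; 5]; [:: 1; 3; 7; 10]; [:: 2; 9; 6; 11]];
      [:: [:: 0; 10; 8; 11]; [:: 1; 7; 4; 9]; [:: 2; 3; 6; 5]];
      [:: [:: 0; 3; 10; 6]; [:: 1; 4; 2; 8]; [:: 5; 9; 7; 11]];
      [:: [:: 0; 8; 3; 9]; [:: 1; 6; 4; 11]; [:: 2; 7; 5; 10]];
      [:: [:: 0; 1; 2]; [:: 3; 4; 5]; [:: 6; 7; 8]; [:: 9; 10; 11]]]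
  (* The case q = 5. *)
  | _ => [::
      [:: [:: 0; 1; 4; 9]; [:: 2; 3; 6; 7]; [:: 5; 8; 10; 11]];
      [:: [:: 0; 10; 9; 11]; [:: 1; 6; 5; 7]; [:: 2; 4; 3; 8]];
      [:: [:: 0; 5; 4; 8]; [:: 1; 2; 6; 9]; [:: 3; 10; 7; 11]];
      [:: [:: 0; 3; 7; 4]; [:: 1; 5; 9; 8]; [:: 2; 10; 6; 11]];
      [:: [:: 0; 6; 8; 7]; [:: 1; 10; 4; 11]; [:: 2; 5; 3; 9]]]
  end.

(** * Assembly of the decompositions on 48 points *)

(** Dividing [r.-1] rather than [r] keeps q at least 1; the cap t = 6 lets q reach 4 and 5 for r =
    22 and 23. The factors from the copies stand in the middle so that all 3 t + q = r C_4-factors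
    precede the C_3-factors. *)
Definition factors48 (r : nat) : seq (seq (seq nat)) :=
  let t := minn (r.-1 %/ 3) 6 in
  let q := r - 3 * t in
  let bs := base_classes t in
  let ks := map on_copies (K12_factors q) in
  flatten (map develop (take t bs)) ++ ks ++ flatten (map develop (drop t bs)).

(** Evaluation of the test on the explicit decomposition for each r from 1 to 23. *)
Lemma factors48_check : all (fun r => HWP43_check 48 r (factors48 r)) (iota 1 23).
Proof. by vm_compute. Qed.

Lemma size_factors48 r :
  HWP43_check 48 r (factors48 r) -> size (factors48 r) = 23.
Proof. by case/and4P=> /eqP[sz] _ _ _; apply: double_inj. Qed.

Theorem mainTheorem9 (r s : nat) :
  0 < r -> r != 6 -> (HWP43 48 r s <-> r + s = 23).
Proof.
move=> r_gt0 _; split=> [/(@HWP43_necessary 48 _ _ isT)[sz] | rs].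
  exact/double_inj/esym.
have ok : HWP43_check 48 r (factors48 r).
  apply: (allP factors48_check r).
  by rewrite mem_iota r_gt0 -[_ + 23]/(23.+1) ltnS -rs leq_addr.
by apply: (HWP43_checkP ok); rewrite (size_factors48 ok).
Qed.
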